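(* Let $g\in G(N)$ be a network with a stellar component $C$ which has depth $\ell\ge 1$ and contains more than $k$ receivers. Suppose that there are at least $\ell$ receivers outside of $C$. Then there exists an extension $g^+$ of $g$ that strictly benefits the sender, i.e. $\operatorname{Val}_k(g^+)>\operatorname{Val}_k(g)$. Moreover, the sender's value for this extension is $\operatorname{Val}_k(g^+)=V_k^n$.
   Context: **Persuasion model.** $N=\{1,\dots,n\}$ is the set of receivers, $\Omega=\{X,Y\}$ the set of states, $\lambda^0$ a common prior on $\Omega$ with $\lambda^0(X),\lambda^0(Y)>0$. The critical mass $k$ is an integer with $\lfloor\frac{n+1}{2}\rfloor\le k\le n$, and $\lambda^0(X)<\frac{k}{n+k}$. All receivers have the same countably infinite message set $S_i$ (containing $x,y$); $S=\prod_{i\in N}S_i$ is the set of signals. An experiment is a map $\pi:\Omega\to\Delta(S)$, where $\Delta(S)$ is the set of finitely supported probability distributions on $S$; $\Pi$ is the set of all experiments; $S^\pi=\{s\in S:\exists\omega\in\Omega,\ \pi(s|\omega)>0\}$. A network $g$ on $N$ is an undirected graph, $g_{ij}=g_{ji}\in\{0,1\}$; $G(N)$ is the set of all networks on $N$; $g_0$ is the empty network. The neighborhood is $N_i(g)=\{j: g_{ij}=1\}\cup\{i\}$. A component is a connected component. A network $g^+\in G(N)$ is an extension of $g$ (written $g\subsetneq g^+$) if it is obtained from $g$ by adding one or more links (same set of receivers). Receiver $i$ observes $s_i(g)=(s_j)_{j\in N_i(g)}$. For $s\in S^\pi$ let $A_i^\pi(g,s)=\{t\in S^\pi: t_i(g)=s_i(g)\}$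 and let the posterior be $$\lambda_i^{s,g}(\omega)=\frac{\sum_{t\in A_i^\pi(g,s)}\pi(t|\omega)\lambda^0(\omega)}{\sum_{\omega'\in\Omega}\sum_{t\in A_i^\pi(g,s)}\pi(t|\omega')\lambda^0(\omega')}.$$ Receiver $i$ takes action $x$ if $\lambda_i^{s,g}(X)\ge\frac12$ and action $y$ otherwise. The outcome is $x$ if at least $k$ receivers take action $x$, and $y$ otherwise. The value $V_k^\pi(g)$ of $\pi$ on $g$ is the (unconditional, under $\lambda^0$ and $\pi$) probability that the outcome is $x$. The value of the network is $\operatorname{Val}_k(g)=\sup_{\pi\in\Pi}V_k^\pi(g)$. $V_k^n:=\operatorname{Val}_k(g_0)$ is the value of the empty network on $n$ receivers; under the assumption $\lambda^0(X)<\frac{k}{n+k}$ it is known that $V_k^n=\frac{n+k}{k}\lambda^0(X)<1$. **Stellar networks.** A stellar network is a network that either (i) consists of a single node; or (ii) contains a node $r$ (the root) connected to all other nodes, such that the other nodes are partitioned into at least two disjoint nonempty subsets, each of which (with the induced links) is itself a stellar network, and no edges connect nodes in different partition elements. A stellar network has an associated directed rooted tree: the root is $r$, its children are the roots of the stellar networks on the partition elements, and so on recursively (a single-node network is its own root). The depth of a node is the number of edges on the path from the root to it in this tree, and the depth of the stellar network is the maximum depth of a node. A stellar component of $g$ is a component that is a stellar network. *)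

(* Defs.v *)
From HB Require Import structures.
From mathcomp Require Import all_boot all_order all_algebra.
From mathcomp Require Import all_classical all_reals.

Set Implicit Arguments.
Unset Strict Implicit.
Unset Printing Implicit Defensive.

Import Order.TTheory GRing.Theory Num.Theory.

Local Open Scope classical_set_scope.
Local Open Scope ring_scope.

Inductive state := X | Y.

Definition bool_of_state (w : state) : bool := if w is X then true else false.
Definition state_of_bool (b : bool) : state := if b then X else Y.

Lemma bool_of_stateK : cancel bool_of_state state_of_bool.
Proof. by case. Qed.

HB.instance Definition _ := Finite.copy state (can_type bool_of_stateK).

Record network (n : nat) := Network {
  link :> rel 'I_n;
  link_sym : symmetric link;
  link_irr : irreflexive link }.

Definition empty_network (n : nat) : network n :=
  @Network n (fun _ _ => false) (fun _ _ => erefl) (fun _ => erefl).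

Definition neighborhood (n : nat) (g : network n) (i : 'I_n) : {set 'I_n} :=
  [set j | (j == i) || g i j]%SET.

Definition extension (n : nat) (g g' : network n) : Prop :=
  subrel g g' /\ exists i j, g' i j && ~~ g i j.

Definition component (n : nat) (g : network n) (C : {set 'I_n}) : Prop :=
  exists i, C = [set j | connect g i j]%SET.

Inductive rtree (T : Type) := RNode of T & seq (rtree T).

(* The nodes of a rooted tree, each paired with its depth, i.e. the number of
   edges on the path from the root to it. *)
Fixpoint node_depths (T : Type) (t : rtree T) : seq (T * nat) :=
  let: RNode r ts := t in
  (r, 0%N) :: [seq (p.1, p.2.+1) | p <- flatten (map (@node_depths T) ts)].

Definition depth (T : Type) (t : rtree T) : nat :=
  (\max_(p <- node_depths t) p.2)%N.

(* [stellar e A t]: the network induced by the links e on the set of nodes A is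
   stellar, with associated rooted tree t. Only links between nodes of A are
   used. The order of the children, given by the enumeration of P, is
   irrelevant. Blocks of a [partition] are nonempty. *)
Inductive stellar (T : finType) (e : rel T) : {set T} -> rtree T -> Prop :=
| stellar_single (r : T) : stellar e [set r]%SET (RNode r [::])
| stellar_root (r : T) (A : {set T}) (P : {set {set T}})
    (child : {set T} -> rtree T) :
    r \in A ->
    (forall v, v \in (A :\ r)%SET -> e r v) ->
    finset.partition P (A :\ r)%SET ->
    (2 <= #|P|)%N ->
    (forall B, B \in P -> stellar e B (child B)) ->
    (forall B B' u v, B \in P -> B' \in P -> B != B' ->
       u \in B -> v \in B' -> ~~ e u v) ->
    stellar e A (RNode r [seq child B | B <- enum P]).

(* Finitely supported probability distributions. Since the support is finite,
   the sum in [fsdist_sum1] is the genuine total mass. *)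
Record fsdist (R : realType) (T : choiceType) := FSDist {
  fsdist_fun :> T -> R;
  fsdist_ge0 : forall t, 0 <= fsdist_fun t;
  fsdist_fin : finite_set [set t | fsdist_fun t != 0];
  fsdist_sum1 : \sum_(t \in [set: T]) fsdist_fun t = 1 }.

Definition signal (n : nat) (M : choiceType) : choiceType := {ffun 'I_n -> M}.

(* [pi w s] is the probability pi(s | w). *)
Definition experiment (R : realType) (n : nat) (M : choiceType) : Type :=
  state -> fsdist R (signal n M).

Section Persuasion.
Context (R : realType) (n : nat) (M : choiceType).
Implicit Types (prior : state -> R) (pi : experiment R n M) (g : network n).
Implicit Types (s : signal n M) (i : 'I_n) (k : nat) (w : state).

Definition sent_signals pi : set (signal n M) :=
  [set s | exists w, 0 < pi w s].

Definition info_set pi g i s : set (signal n M) :=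
  [set t | sent_signals pi t /\
           forall j, j \in neighborhood g i -> t j = s j].

Definition posterior prior pi g i s w : R :=
  (\sum_(t \in info_set pi g i s) pi w t * prior w) /
  (\sum_(w' : state) \sum_(t \in info_set pi g i s) pi w' t * prior w').

Definition takes_x prior pi g s i : bool := 2^-1 <= posterior prior pi g i s X.

Definition outcome_x k prior pi g s : bool :=
  (k <= #|[set i | takes_x prior pi g s i]%SET|)%N.

Definition value k prior g pi : R :=
  \sum_(w : state) prior w *
    \sum_(s \in [set s | sent_signals pi s /\ outcome_x k prior pi g s])
      pi w s.

End Persuasion.

(* The supremum is over a nonempty set of reals of [0, 1]. *)
Definition network_value (R : realType) (n : nat) (M : choiceType) (k : nat)
    (prior : state -> R) (g : network n) : R :=
  sup [set value k prior g pi | pi in [set: experiment R n M]].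

(* Main.v *)
(* On any network each receiver takes x with at most the probability
   a = prior X in state Y (by obedience), so that k P(outcome x, Y) <= n a and
   the value is at most V = (n + k) a / k. If all receivers of a set C with more
   than k elements act on coarser information than some member r of C, as in a
   stellar component with root r, then near the optimum all of C take x
   together, which wastes votes; this bounds the value away from V.

   Conversely, V is attained as soon as a suitable random coalition of size k
   can be told privately to take x. XOR secret sharing does this: the bit of a
   receiver is split into shares carried by the messages of its neighborhood,
   so that exactly the receivers whose neighborhoods contain that one learn the
   bit. Linking the nodes of depth d > 0 of the stellar component to the d-th
   outside receiver leaves no inclusions between neighborhoods except among
   outside receivers, and these can be kept together in the random coalition. *)

Require Import Defs.
From HB Require Import structures.
From mathcomp Require Import all_boot all_order all_algebra.
From mathcomp Require Import all_classical all_reals.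
From mathcomp Require Import ring lra zify.

Set Implicit Arguments.
Unset Strict Implicit.
Unset Printing Implicit Defensive.

Import Order.TTheory GRing.Theory Num.Theory.

Local Open Scope classical_set_scope.
Local Open Scope ring_scope.

(** * Sums over states and over equivalence classes *)

Lemma big_state (R : realType) (F : state -> R) :
  \sum_(w : state) F w = F X + F Y.
Proof.
by rewrite (bigD1 X)//= (bigD1 Y)//= big1 ?addr0//; case.
Qed.

(* Replacing f and h by their averages over classes does not change the sums. *)
Lemma ler_sum_classes (R : realFieldType) (T : eqType) (r : seq T) (e : rel T)
    (Q : pred T) (f h : T -> R) :
  reflexive e -> symmetric e -> transitive e ->
  (forall s t, e s t -> Q s = Q t) ->
  (forall s, s \in r -> Q s ->
     \sum_(t <- r | e s t) f t <= \sum_(t <- r | e s t) h t) ->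
  \sum_(s <- r | Q s) f s <= \sum_(s <- r | Q s) h s.
Proof.
move=> er es et eQ le_fh.
pose c s : R := \sum_(t <- r | e s t) 1.
have c_gt0 s : s \in r -> 0 < c s.
  move=> sr; rewrite /c (big_rem s)//= er ltr_pwDl// sumr_ge0//.
have c_eq s t : e s t -> c s = c t.
  move=> est; apply: eq_bigl => u; apply/idP/idP; last exact: et.
  by apply: et; rewrite es.
(* Double counting: [F s] is collected once by each of the [c s] entries of its class, each time
   with weight [(c s)^-1]. *)
have avg (F : T -> R) : \sum_(s <- r | Q s) F s =
    \sum_(s <- r | Q s) (c s)^-1 * \sum_(t <- r | e s t) F t.
  transitivity (\sum_(s <- r | Q s) \sum_(t <- r | e s t) (c t)^-1 * F s).
    rewrite big_seq_cond [RHS]big_seq_cond; apply: eq_bigr => s /andP[sr _].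
    under eq_bigr => t /c_eq <- do rewrite -[_^-1]mul1r -mulrA.
    by rewrite -mulr_suml -/(c s) mulrA mulfV ?mul1r// gt_eqF ?c_gt0.
  rewrite (exchange_big_dep Q)/=; last by move=> s t Qs /eQ <-.
  apply: eq_bigr => t Qt; rewrite mulr_sumr; apply: eq_bigl => s.
  by rewrite es andb_idl// => /eQ <-.
rewrite avg [leRHS]avg big_seq_cond [leRHS]big_seq_cond.
apply: ler_sum => s /andP[sr Qs].
by rewrite ler_wpM2l ?le_fh// invr_ge0 ltW ?c_gt0.
Qed.

(** * Information sets and obedience as finite sums *)

Section FiniteSums.
Context (R : realType) (n : nat) (M : choiceType).
Variables (prior : state -> R) (pi : experiment R n M) (r : seq (signal n M)).
Hypotheses (prior_gt0 : forall w, 0 < prior w) (r_uniq : uniq r).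
Hypothesis sent_r : forall s, sent_signals pi s -> s \in r.
Implicit Types (g : network n) (s t : signal n M) (i : 'I_n) (w : state).

Definition same_view g i s t : bool :=
  [forall j, (j \in neighborhood g i) ==> (t j == s j)].

Lemma same_view_refl g i : reflexive (same_view g i).
Proof. by move=> s; apply/forallP => j; apply/implyP. Qed.

Lemma same_view_sym g i : symmetric (same_view g i).
Proof. by move=> s t; apply: eq_forallb => j; rewrite eq_sym. Qed.

Lemma same_view_trans g i : transitive (same_view g i).
Proof.
move=> t s u /forallP st /forallP tu; apply/forallP => j; apply/implyP => jN.
by rewrite (eqP (implyP (tu j) jN)) (implyP (st j) jN).
Qed.

Lemma unsent w s : ~ sent_signals pi s -> pi w s = 0.
Proof.
move=> sN; apply/eqP; rewrite eq_le fsdist_ge0 andbT leNgt.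
by apply/negP => s_gt0; apply: sN; exists w.
Qed.

Lemma fsum_sent w (P : pred (signal n M)) :
  \sum_(s \in [set s | sent_signals pi s /\ P s]) pi w s =
  \sum_(s <- r | P s) pi w s.
Proof.
rewrite [RHS]bigfs//; last first.
  by move=> s _ sr; apply: unsent => /sent_r; exact/negP.
apply: fsbig_widen => [s [_ Ps]|s [/= Ps sN]]; first exact: Ps.
by apply: unsent => ss; apply: sN.
Qed.

Lemma info_setE g i s :
  info_set pi g i s = [set t | sent_signals pi t /\ same_view g i s t].
Proof.
apply/seteqP; split=> t /= [tsent st]; split=> //.
  by apply/forallP => j; apply/implyP => /st ->.
by move=> j jN; apply/eqP; move/forallP: st => /(_ j)/implyP; apply.
Qed.

Lemma sum_sent_gt0 w s (P : pred (signal n M)) : 0 < pi w s -> P s ->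
  0 < \sum_(t <- r | P t) pi w t.
Proof.
move=> s_gt0 Ps; have sr : s \in r by apply: sent_r; exists w.
rewrite (big_rem s)//= Ps ltr_pwDl// sumr_ge0// => t _; exact: fsdist_ge0.
Qed.

(** A sent signal has positive weight in its own information set, so the denominator of the
    posterior is positive and the threshold 1/2 becomes a comparison of joint weights. *)
Lemma takes_xE g i s : sent_signals pi s ->
  takes_x prior pi g s i =
  (\sum_(t <- r | same_view g i s t) pi Y t * prior Y <=
   \sum_(t <- r | same_view g i s t) pi X t * prior X).
Proof.
move=> [w s_gt0]; rewrite /takes_x /posterior big_state info_setE.
rewrite -!mulr_fsuml !fsum_sent -!mulr_suml.
set a := _ * prior X; set b := _ * prior Y.
have ge0 v : 0 <= (\sum_(t <- r | same_view g i s t) pi v t) * prior v.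
  by rewrite mulr_ge0 ?(ltW (prior_gt0 _))// sumr_ge0// => t _; exact: fsdist_ge0.
have ab_gt0 : 0 < a + b.
  have : 0 < (\sum_(t <- r | same_view g i s t) pi w t) * prior w.
    by rewrite mulr_gt0//; apply: sum_sent_gt0 s_gt0 (same_view_refl _ _ _).
  have := ge0 X; have := ge0 Y; rewrite -/a -/b.
  by case: w {s_gt0}; rewrite -?/a -?/b; lra.
rewrite ler_pdivlMr//; lra.
Qed.

Lemma eq_takes_x g i s t : same_view g i s t ->
  takes_x prior pi g s i = takes_x prior pi g t i.
Proof.
move=> st; rewrite /takes_x /posterior.
suff -> : info_set pi g i s = info_set pi g i t by [].
rewrite !info_setE; apply/seteqP; split=> u [us su]; split=> //.
  by apply: same_view_trans su; rewrite same_view_sym.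
exact: same_view_trans st su.
Qed.

Lemma valueE k g : value k prior g pi =
  prior X * (\sum_(s <- r | outcome_x k prior pi g s) pi X s) +
  prior Y * (\sum_(s <- r | outcome_x k prior pi g s) pi Y s).
Proof. by rewrite /value big_state !fsum_sent. Qed.

Lemma sum_experiment w : \sum_(s <- r) pi w s = 1.
Proof.
rewrite -(fsdist_sum1 (pi w)) -(fsum_sent w predT).
apply: fsbig_widen => // s [_ /= sN]; apply: unsent => ss; apply: sN; split=> //.
Qed.

(** Obedience on a union of information sets: [Q] is such a union, and on each class state X weighs
    at least as much as state Y. *)
Lemma ler_sum_takes_x g i (Q : pred (signal n M)) :
  (forall s, s \in r -> sent_signals pi s) ->
  (forall s t, same_view g i s t -> Q s = Q t) ->
  (forall s, Q s -> takes_x prior pi g s i) ->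
  \sum_(s <- r | Q s) pi Y s * prior Y <= \sum_(s <- r | Q s) pi X s * prior X.
Proof.
move=> r_sent Qview Qx; apply: ler_sum_classes Qview _ => [||| s sr Qs].
- exact: same_view_refl.
- exact: same_view_sym.
- exact: same_view_trans.
- by rewrite -takes_xE ?Qx//; exact: r_sent.
Qed.
End FiniteSums.

(** * Upper bounds on the value of an experiment *)

Section Bounds.
Context (R : realType) (n k : nat) (M : choiceType).
Variables (prior : state -> R) (pi : experiment R n M) (g : network n).
Hypothesis prior_gt0 : forall w, 0 < prior w.

Let r : seq (signal n M) :=
  finmap.enum_fset (fset_set (sent_signals pi)).

Let finite_sent : finite_set (sent_signals pi).
Proof.
apply: (@sub_finite_set _ _ ([set s | pi X s != 0] `|` [set s | pi Y s != 0])).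
  by move=> s [[]] /lt0r_neq0 ?; [left|right].
by rewrite finite_setU; split; exact: fsdist_fin.
Qed.

Let sent_r s : sent_signals pi s -> s \in r.
Proof. by move=> ss; rewrite (in_fset_set finite_sent) inE. Qed.

Let r_sent s : s \in r -> sent_signals pi s.
Proof. by rewrite (in_fset_set finite_sent) inE. Qed.

Let r_uniq : uniq r. Proof. exact: finmap.fset_uniq. Qed.

(** The integral of a counting function against the joint weights in state [w]; it turns pointwise
    inequalities between numbers of votes into inequalities between probabilities. *)
Let mass w (N : signal n M -> nat) : R :=
  \sum_(s <- r) (pi w s * prior w) *+ N s.

Let massE w (Q : pred (signal n M)) :
  mass w Q = \sum_(s <- r | Q s) pi w s * prior w.
Proof. by rewrite big_mkcond; apply: eq_bigr => s _; rewrite mulrb. Qed.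

Let massD w N N' : mass w (fun s => N s + N' s)%N = mass w N + mass w N'.
Proof. by rewrite -big_split; apply: eq_bigr => s _; rewrite mulrnDr. Qed.

Let mass_sum w (A : pred 'I_n) (N : 'I_n -> signal n M -> nat) :
  mass w (fun s => \sum_(i | A i) N i s)%N = \sum_(i | A i) mass w (N i).
Proof.
by rewrite exchange_big; apply: eq_bigr => s _; rewrite -sumrMnr.
Qed.

Let le_mass w N N' : (forall s, N s <= N' s)%N -> mass w N <= mass w N'.
Proof.
move=> NN'; apply: ler_sum => s _; apply: ler_wpMn2l => //.
by rewrite mulr_ge0 ?fsdist_ge0// ltW.
Qed.

Let mass1 w : mass w (fun=> 1%N) = prior w.
Proof.
rewrite -[RHS]mul1r -(sum_experiment r_uniq sent_r w) mulr_suml.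
by apply: eq_bigr.
Qed.

Let E i s := takes_x prior pi g s i.
Let D s := outcome_x k prior pi g s.

Let ED_view i s t : same_view g i s t -> E i s = E i t.
Proof. exact: eq_takes_x. Qed.

Let massE_le i : mass Y (E i) <= mass X (E i).
Proof.
rewrite !massE.
apply: (ler_sum_takes_x prior_gt0 r_uniq sent_r r_sent _ (i:=i) (g:=g)) => //.
by move=> s t; exact: ED_view.
Qed.

Let massE_le_prior i : mass X (E i) <= prior X.
Proof. by rewrite -mass1; apply: le_mass => s; case: (E i s). Qed.

Let takers s : #|[set i | E i s]%SET| = (\sum_i E i s)%N.
Proof.
by rewrite -sum1_card big_mkcond; apply: eq_bigr => i _; rewrite inE; case: (E i s).
Qed.

Let valueD : value k prior g pi <= prior X + mass Y D.
Proof.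
rewrite (valueE _ r_uniq sent_r) massE -mulr_suml [prior Y * _]mulrC lerD2r.
rewrite mulrC mulr_suml -massE -[leRHS]mass1.
by apply: le_mass => s; rewrite leq_b1.
Qed.

(** A Markov inequality: each outcome x uses at least [k] votes. *)
Let kmassD : k%:R * mass Y D <= \sum_i mass Y (E i).
Proof.
rewrite -mass_sum mulr_natl -sumrMnl; apply: ler_sum => s _.
rewrite -mulrnA; apply: ler_wpMn2l.
  by rewrite mulr_ge0 ?fsdist_ge0// ltW.
rewrite -takers mulnC /D /outcome_x; by case: (leqP k) => [|_]; rewrite ?muln1 ?muln0.
Qed.

Let sum_prior : \sum_(i : 'I_n) prior X = n%:R * prior X.
Proof. by rewrite big_const iter_addr_0 card_ord mulr_natl. Qed.

Lemma value_le : (0 < k)%N -> value k prior g pi <= (n + k)%:R / k%:R * prior X.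
Proof.
move=> k_gt0; apply: le_trans valueD _.
have k0 : 0 < k%:R :> R by rewrite ltr0n.
rewrite -(ler_pM2l k0) mulrDr mulrA mulrCA mulfV ?gt_eqF// mulr1.
rewrite natrD mulrDl addrC lerD2r; apply: le_trans kmassD _.
rewrite -sum_prior; apply: ler_sum => i _.
exact: le_trans (massE_le i) (massE_le_prior i).
Qed.

(* If everyone in C acts on coarser information than r, then at the optimum r
   and all of C take x on the same event, so that more than k receivers do. The
   event [Z i] measures the deviation from this. *)
Lemma value_le_universal (r0 : 'I_n) (C : {set 'I_n}) : r0 \in C -> (k < #|C|)%N ->
  (0 < k)%N ->
  (forall i, i \in C -> neighborhood g i \subset neighborhood g r0) ->
  value k prior g pi <= ((n + k)%:R / k%:R - (2 * k)%:R^-1) * prior X.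
Proof.
move=> r0C kC k_gt0 nbrs; apply: le_trans valueD _.
have k0 : 0 < k%:R :> R by rewrite ltr0n.
pose Z i s : bool := E r0 s && ~~ E i s.
(* The view of [r0] determines that of [i], so [Z i] is an event that [r0] can see, and on it [r0]
   takes x. *)
have Z_le i : i \in C -> mass Y (Z i) <= mass X (Z i).
  move=> iC; rewrite !massE.
  apply: (ler_sum_takes_x prior_gt0 r_uniq sent_r r_sent _ (i:=r0) (g:=g)).
    move=> s t st; rewrite /Z (ED_view st); congr (_ && ~~ _); apply: ED_view.
    apply/forallP => j; apply/implyP => /(fintype.subsetP (nbrs i iC)) jr.
    by move/forallP: st => /(_ j)/implyP; apply.
  by move=> s /andP[].
have Z_X i : mass X (Z i) <= prior X - mass X (E i).
  rewrite lerBrDr -mass1 -massD; apply: le_mass => s; rewrite /Z.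
  by case: (E r0 s) (E i s) => -[].
(* Pointwise, if [r0] takes x, then either all of [C] does, which gives at least [k + 1] votes, or
   some [i] in [C] does not and [Z i] supplies the extra unit. *)
have key : k%:R * mass Y D + mass Y (E r0) <=
    \sum_i mass Y (E i) + \sum_(i in C) mass Y (Z i).
  rewrite -!mass_sum -massD mulr_natl -sumrMnl -big_split/=.
  apply: ler_sum => s _; rewrite -mulrnA -mulrnDr; apply: ler_wpMn2l.
    by rewrite mulr_ge0 ?fsdist_ge0// ltW.
  rewrite -takers mulnC.
  have kD : (k * D s <= #|[set i | E i s]%SET|)%N.
    by rewrite /D /outcome_x; case: (leqP k) => [|_]; rewrite ?muln1 ?muln0.
  case r0s : (E r0 s); last by rewrite addn0 (leq_trans kD)// leq_addr.
  have [|/fintype.subsetPn[i iC iE]] := boolP (C \subset [set i | E i s]%SET).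
    move/subset_leq_card => CE; rewrite (leq_trans _ (leq_addr _ _))//.
    apply: leq_trans CE; rewrite addn1 (leq_trans _ kC)// ltnS.
    by rewrite -[leqRHS]muln1 leq_mul// leq_b1.
  apply: leq_add kD _; rewrite (bigD1 i)//= {1}/Z r0s.
  by move: iE; rewrite inE => ->.
have sumC : \sum_(i in C) mass Y (Z i) <=
    \sum_i (prior X - mass X (E i)).
  rewrite big_mkcond; apply: ler_sum => i _.
  case: ifP => iC; last by rewrite subr_ge0.
  exact: le_trans (Z_le i iC) (Z_X i).
have sumYX : \sum_i mass Y (E i) <= \sum_i mass X (E i).
  by apply: ler_sum.
have low : k%:R * mass Y D <= mass Y (E r0) + (n%:R * prior X - prior X).
  apply: le_trans kmassD _; rewrite -sum_prior (bigD1 r0)//= [in leRHS](bigD1 r0)//=.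
  rewrite lerD2l addrAC subrr add0r; apply: ler_sum => i _.
  exact: le_trans (massE_le i) (massE_le_prior i).
rewrite sumrB sum_prior in sumC.
have -> : ((n + k)%:R / k%:R - (2 * k)%:R^-1) * prior X =
    prior X + (n%:R * prior X - prior X / 2) / k%:R.
  by rewrite natrD natrM; field; rewrite ?gt_eqF.
(* With [sumC] and [sumYX], [key] bounds its left side by [n%:R * prior X]. Adding [low] cancels
   [mass Y (E r0)], and halving leaves the loss [prior X / 2]. *)
rewrite lerD2l ler_pdivlMr// mulrC; lra.
Qed.
End Bounds.

(** * Distributions on finite types and XOR secret sharing *)

Lemma fsdist_image (R : realType) (T : finType) (S : choiceType) (e : T -> S)
    (d : T -> R) : injective e -> (forall t, 0 <= d t) -> \sum_t d t = 1 ->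
  exists f : fsdist R S,
    (forall t, f (e t) = d t) /\ (forall s, (forall t, e t != s) -> f s = 0).
Proof.
move=> e_inj d_ge0 d_sum1; pose f s := \sum_(t | e t == s) d t.
have fe t : f (e t) = d t.
  by rewrite /f (big_pred1 t)// => u; rewrite inj_eq.
have f_out s : (forall t, e t != s) -> f s = 0.
  by move=> es; rewrite /f big_pred0// => t; exact/negbTE.
have f_supp s : s \notin [seq e t | t <- enum T] -> f s = 0.
  move=> sN; apply: f_out => t; apply: contraNneq sN => <-; by rewrite map_f ?mem_enum.
have f_ge0 s : 0 <= f s by apply: sumr_ge0.
have f_fin : finite_set [set s | f s != 0].
  apply: (@sub_finite_set _ _ [set` [seq e t | t <- enum T]]); last exact: finite_seq.
  move=> s /= fs; apply/negPn/negP => /f_supp fs0; by rewrite fs0 eqxx in fs.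
have f_sum1 : \sum_(s \in [set: S]) f s = 1.
  rewrite (@fsbigE _ _ _ _ _ [seq e t | t <- enum T])//; last first.
  - by move=> ? _; exact: f_supp.
  - by rewrite map_inj_uniq ?enum_uniq.
  by rewrite big_map big_enum_cond/= -[RHS]d_sum1; apply: eq_big => t; rewrite ?in_setT.
by exists (FSDist f_ge0 f_fin f_sum1).
Qed.

Section Shares.
Variables (n : nat) (g : network n).
Implicit Types (i j : 'I_n) (B D : {set 'I_n}) (h : 'I_n -> 'I_n).

(* [sigma j i] is the share of the secret bit of receiver [i] that is contained
   in the message to receiver [j]. *)
Definition shares := {ffun 'I_n -> {ffun 'I_n -> bool}}.
Implicit Type sigma : shares.

Definition bits sigma : {set 'I_n} :=
  [set i | \big[addb/false]_(j in neighborhood g i) sigma j i]%SET.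

(** Changing the one share held by [h i] flips the secret bit of [i] when [h i] is in its
    neighborhood; a holder outside the view of an observer leaves that view unchanged. *)
Definition flip h D sigma : shares :=
  [ffun j => [ffun i => sigma j i (+) ((i \in D) && (j == h i))]].

Lemma flipK h D : involutive (flip h D).
Proof.
by move=> sigma; apply/ffunP => j; apply/ffunP => i; rewrite !ffunE addbK.
Qed.

Lemma in_bits_flip h D sigma i : (forall i, i \in D -> h i \in neighborhood g i) ->
  (i \in bits (flip h D sigma)) = (i \in bits sigma) (+) (i \in D).
Proof.
move=> hN; rewrite !inE.
under eq_bigr do rewrite !ffunE.
rewrite big_split/=; congr (_ (+) _).
case: (boolP (i \in D)) => [iD|_] /=; last by rewrite big1_eq.
rewrite (bigD1 (h i)) ?hN//= eqxx big1 ?addbF// => j /andP[_ /negbTE->] //.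
Qed.

(** Flipping the bits in the symmetric difference of [B] and [B'] is injective. The predicate [Q]
    will record what one receiver observes. *)
Lemma card_bits_le h B B' (Q : pred shares) :
  (forall i, (i \in B) != (i \in B') -> h i \in neighborhood g i) ->
  (forall D sigma, (forall i, i \in D -> (i \in B) != (i \in B')) ->
     Q sigma -> Q (flip h D sigma)) ->
  (#|[set sigma | Q sigma & bits sigma == B]%SET| <=
   #|[set sigma | Q sigma & bits sigma == B']%SET|)%N.
Proof.
move=> hN hQ; pose D := [set i | (i \in B) != (i \in B')]%SET.
rewrite -(card_imset _ (can_inj (flipK h D))); apply: subset_leq_card.
apply/fintype.subsetP => _ /imsetP[sigma /[!inE] /andP[Qs /eqP sB] ->].
rewrite hQ//=; last by move=> i; rewrite inE.
apply/eqP/setP => i; rewrite in_bits_flip ?sB => [|j]; rewrite inE; last exact: hN.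
by case: (i \in B) (i \in B') => -[].
Qed.

(** By [card_bits] every set of bits has this many encodings, so it normalizes the uniform law on
    the arrays with given bits. *)
Definition num_shares : nat := #|[set sigma | bits sigma == [set: 'I_n]%SET]%SET|.

Lemma card_bits B : #|[set sigma | bits sigma == B]%SET| = num_shares.
Proof.
have le B1 B2 : (#|[set sigma | bits sigma == B1]%SET| <=
                 #|[set sigma | bits sigma == B2]%SET|)%N.
  apply: (@card_bits_le id _ _ predT) => // i _; by rewrite !inE eqxx.
by apply/eqP; rewrite eqn_leq !le.
Qed.

Lemma num_shares_gt0 : (0 < num_shares)%N.
Proof.
rewrite -(card_bits (bits [ffun=> [ffun=> false]])).
by apply/card_gt0P; exists [ffun=> [ffun=> false]]; rewrite inE.
Qed.

End Shares.

(** * The sharing experiment and its value *)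

Section SharingExperiment.
Context (R : realType) (n k : nat) (M : choiceType).
Variables (prior : state -> R) (g : network n).
Variables (J : finType) (p : J -> R) (B : J -> {set 'I_n}).
Hypotheses (M_infinite : infinite_set [set: M]) (prior_gt0 : forall w, 0 < prior w).
Hypotheses (k_le : (k <= n)%N) (p_ge0 : forall j, 0 <= p j) (p_sum1 : \sum_j p j = 1).
Hypothesis obedient : forall i, (\sum_(j | i \in B j) p j) * prior Y <= prior X.
(* Receiver [i] learns the secret bit of [i'] if its neighborhood contains that
   of [i'], so this bit must not discourage [i] from taking x. *)
Hypothesis nested : forall i i' j,
  neighborhood g i' \subset neighborhood g i -> i \in B j -> i' \in B j.

(** The law of [sigma] when [j] is drawn with weight [q j], and then an array with bits [A j]
    uniformly. *)
Let share_weight (K : finType) (q : K -> R) (A : K -> {set 'I_n})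
    (sigma : shares n) : R :=
  (\sum_j q j *+ (bits g sigma == A j)) / (num_shares g)%:R.

Let N_neq0 : (num_shares g)%:R != 0 :> R.
Proof. by rewrite pnatr_eq0 -lt0n num_shares_gt0. Qed.

Let share_weight_ge0 (K : finType) (q : K -> R) A sigma :
  (forall j, 0 <= q j) -> 0 <= @share_weight K q A sigma.
Proof.
by move=> q0; rewrite mulr_ge0 ?invr_ge0 ?ler0n// sumr_ge0// => j _; rewrite mulrn_wge0.
Qed.

Let sum_share_weight (K : finType) (q : K -> R) A (Q : pred (shares n)) :
  \sum_(sigma | Q sigma) @share_weight K q A sigma =
  \sum_j q j * #|[set sigma | Q sigma & bits g sigma == A j]%SET|%:R /
    (num_shares g)%:R.
Proof.
rewrite /share_weight -!mulr_suml exchange_big; congr (_ / _); apply: eq_bigr => j _.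
rewrite sumrMnr mulr_natr; congr (_ *+ _).
by rewrite -sum1dep_card big_mkcondr; apply: eq_bigr => s _; case: eqP.
Qed.

(** In state X all secret bits are 1; in state Y they are the indicator of the random coalition
    [B j]. Receivers with bit 1 take x. *)
Lemma sharing_experiment : exists pi : experiment R n M,
  prior X + prior Y * (\sum_(j | (k <= #|B j|)%N) p j) <= value k prior g pi.
Proof.
have [enc enc_inj] : exists enc : {ffun 'I_n -> bool} -> M, injective enc.
  have /infiniteP/card_leP[f] := M_infinite.
  pose u m : set_type [set: nat] := SigSub (mem_set (I : [set: nat] m)).
  exists (fun c => val (f (u (enum_rank c)))) => c c' /val_inj/(@inj _ _ _ f).
  by rewrite !in_setT => /(_ isT isT)/(congr1 val)/=/val_inj/enum_rank_inj.
pose e (sigma : shares n) : signal n M := [ffun j => enc (sigma j)].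
have e_inj : injective e.
  move=> s t /ffunP st; apply/ffunP => j; apply: enc_inj.
  by have := st j; rewrite !ffunE.
pose dX := @share_weight unit (fun=> 1) (fun=> [set: 'I_n]%SET).
pose dY := share_weight p B.
have dX_ge0 sigma : 0 <= dX sigma by apply: share_weight_ge0.
have dY_ge0 sigma : 0 <= dY sigma by apply: share_weight_ge0.
have dX_sum : \sum_sigma dX sigma = 1.
  rewrite sum_share_weight (big_pred1 tt)//=.
  by rewrite mul1r card_bits mulfV.
have dY_sum : \sum_sigma dY sigma = 1.
  rewrite sum_share_weight -[RHS]p_sum1; apply: eq_bigr => j _.
  by rewrite /= card_bits mulfK.
have [fX [fXe fX0]] := fsdist_image e_inj dX_ge0 dX_sum.
have [fY [fYe fY0]] := fsdist_image e_inj dY_ge0 dY_sum.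
pose pi : experiment R n M := fun w => if w is X then fX else fY.
exists pi.
pose r := [seq e sigma | sigma <- enum (shares n)].
have r_uniq : uniq r by rewrite map_inj_uniq ?enum_uniq.
have sent_r s : sent_signals pi s -> s \in r.
  move=> [w]; apply: contraTT => sN; rewrite -leNgt.
  have es t : e t != s by apply: contraNneq sN => <-; by rewrite map_f ?mem_enum.
  by case: w; rewrite /= ?fX0 ?fY0.
have sum_r w d (Q : pred (signal n M)) : (forall sigma, pi w (e sigma) = d sigma) ->
    \sum_(s <- r | Q s) pi w s = \sum_(sigma | Q (e sigma)) d sigma.
  by move=> pid; rewrite big_map big_enum_cond/=; apply: eq_bigr.
have takes sigma i : sent_signals pi (e sigma) -> i \in bits g sigma ->
    takes_x prior pi g (e sigma) i.
  move=> sent_s is_; rewrite (takes_xE prior_gt0 r_uniq sent_r)//.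
  pose Q (tau : shares n) := same_view g i (e sigma) (e tau).
  have QP (tau : shares n) :
      reflect (forall j, j \in neighborhood g i -> tau j = sigma j) (Q tau).
    apply: (iffP forallP) => [Qt j jN|Qt j].
      by move/implyP: (Qt j) => /(_ jN); rewrite !ffunE => /eqP/enc_inj.
    by apply/implyP => jN; rewrite !ffunE Qt.
  rewrite -!mulr_suml (sum_r Y dY)// (sum_r X dX)//.
  rewrite !sum_share_weight (big_pred1 tt)/=; last by case.
  set c := #|[set tau | Q tau & bits g tau == [set: 'I_n]%SET]%SET|%:R.
  (* The view of [i] contains its own bit, which is 1, and so excludes [B j] if [i] is not a member.
     Otherwise, flipping the remaining bits through shares unseen by [i] embeds the arrays for [B j]
     into those with all bits 1. *)
  have cB j : #|[set tau | Q tau & bits g tau == B j]%SET|%:R <=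
      c *+ (i \in B j) :> R.
    case: (boolP (i \in B j)) => [iB|/negP iB]; last first.
      rewrite mulr0n lern0 cards_eq0; apply/eqP/setP => tau; rewrite !inE.
      apply/negP => /andP[/QP Qt /eqP tB]; apply: iB; rewrite -tB.
      move: is_; rewrite !inE; congr (is_true _); apply: eq_bigr => l lN.
      by rewrite Qt.
    rewrite mulr1n ler_nat.
    (* By [nested], each non-member [l] has a share held outside the view of [i]; for members the
       value is arbitrary. *)
    have hP l : exists m, l \notin B j ->
        (m \in neighborhood g l) && (m \notin neighborhood g i).
      case: (boolP (l \in B j)) => [_|lB]; first by exists l.
      have /fintype.subsetPn[m ml mi] : ~~ (neighborhood g l \subset neighborhood g i).
        by apply: contra lB => /nested; apply.
      by exists m; rewrite ml.
    have [h {}hP] := fin_all_exists hP.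
    apply: (@card_bits_le _ _ h) => [l|D tau DB /QP Qt].
      by rewrite finset.in_setT; case: (boolP (l \in B j)) => // /hP/andP[].
    apply/QP => m mN; rewrite -(Qt m mN); apply/ffunP => l; rewrite !ffunE.
    case: (boolP (l \in D)) => [/DB|_]; last by rewrite addbF.
    rewrite finset.in_setT; case: (boolP (l \in B j)) => // /hP/andP[_ hN] _.
    by case: eqP hN => [<-|_ _]; rewrite ?mN ?addbF.
  rewrite mul1r -mulr_suml mulrAC [leRHS]mulrAC ler_wpM2r ?invr_ge0 ?ler0n//.
  apply: (@le_trans _ _ ((\sum_(j | i \in B j) p j) * prior Y * c)).
    rewrite mulrAC ler_wpM2r ?(ltW (prior_gt0 _))//.
    rewrite mulr_suml [leRHS]big_mkcond/=; apply: ler_sum => j _.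
    have := ler_wpM2l (p_ge0 j) (cB j); case: ifP => _ //.
    by rewrite mulr0n mulr0.
  by rewrite mulrC ler_wpM2l ?ler0n// obedient.
have le_outcome w d (K : finType) (q : K -> R) A :
    (forall sigma, pi w (e sigma) = d sigma) -> d =1 @share_weight K q A ->
    \sum_(j | (k <= #|A j|)%N) q j <=
    \sum_(s <- r | outcome_x k prior pi g s) pi w s.
  move=> pid dE; rewrite (sum_r w d)//.
  apply: (@le_trans _ _ (\sum_(sigma | (k <= #|bits g sigma|)%N) d sigma)).
    rewrite (eq_bigr _ (fun sigma _ => dE sigma)) sum_share_weight big_mkcond.
    apply: ler_sum => j _.
    rewrite -mulrA; case: ifP => kA.
      rewrite (_ : [set _ | _ & _]%SET = [set sigma | bits g sigma == A j]%SET).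
        by rewrite card_bits mulfV ?mulr1.
      by apply/setP => sigma; rewrite !inE andb_idl// => /eqP ->.
    rewrite (_ : [set _ | _ & _]%SET = finset.set0) ?cards0 ?mul0r ?mulr0//.
    apply/setP => sigma; rewrite !inE; apply/negP => /andP[].
    by move=> kb /eqP sA; rewrite sA kA in kb.
  rewrite big_mkcond [leRHS]big_mkcond; apply: ler_sum => sigma _.
  have d_ge0 : 0 <= d sigma by rewrite -pid fsdist_ge0.
  case: ifP => kb; last by case: ifP.
  case: (eqVneq (d sigma) 0) => [->|d_neq0]; first by case: ifP.
  rewrite /outcome_x (leq_trans kb)// subset_leq_card//.
  apply/fintype.subsetP => i ib; rewrite inE takes//.
  by exists w; rewrite pid lt_def d_neq0.
rewrite (valueE _ r_uniq sent_r); apply: lerD.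
  rewrite -[leLHS]mulr1 ler_wpM2l ?(ltW (prior_gt0 _))//.
  apply: le_trans (le_outcome X dX _ _ _ fXe (fun=> erefl)).
  by rewrite (big_pred1 tt)//; case; rewrite cardsT card_ord k_le.
by rewrite ler_wpM2l ?(ltW (prior_gt0 _))//; exact: (le_outcome Y dY _ _ _ fYe).
Qed.
End SharingExperiment.

(** * Depths in stellar networks *)

Section StellarNetworks.
Variables (T : finType) (e : rel T).
Implicit Types (A : {set T}) (u v c r : T).

(** What is kept of the tree. [dep_ancestor] and [dep_sibling] give witnesses against inclusions of
    neighborhoods: of a node in a deeper linked node, and of an outside receiver in a node of its
    level. *)
Record depth_function A r (m : nat) (dep : T -> nat) : Prop := DepthFunction {
  root_in : r \in A;
  root_link : forall v, v \in A -> v != r -> e r v;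
  root_dep : dep r = 0%N;
  dep_gt0 : forall v, v \in A -> v != r -> (0 < dep v)%N;
  dep_le : forall v, v \in A -> (dep v <= m)%N;
  dep_link : forall u v, u \in A -> v \in A -> e u v -> dep u != dep v;
  dep_ancestor : forall u v, u \in A -> v \in A -> e u v -> (dep u < dep v)%N ->
    exists c, [/\ c \in A, c != v, e u c & ~~ e v c];
  dep_sibling : forall v, v \in A -> v != r ->
    exists c, [/\ c \in A, c != v, ~~ e v c & dep c = dep v] }.

Lemma depth_child (r : T) (P : {set {set T}}) (child : {set T} -> rtree T) B :
  B \in P -> (depth (child B) < depth (RNode r [seq child C | C <- enum P]))%N.
Proof.
move=> BP; rewrite /depth /= big_cons max0n !big_map big_flatten !big_map/=.
have BP' : B \in enum P by rewrite mem_enum.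
rewrite (big_rem B)//= leq_max; apply/orP; left.
case: (child B) => r' ts /=; move: (r', 0%N) (map _ _) => p s.
elim: s p => [|p' s IH] p; first by rewrite !big_cons !big_nil !maxn0.
by rewrite big_cons [ltnRHS]big_cons gtn_max !leq_max leqnn IH orbT.
Qed.

(** By induction: depth within the block plus one. Since there are two blocks, the root of another
    block is a witness not linked to [v] where the block of [v] gives none. *)
Lemma stellar_depth_function A t : symmetric e -> irreflexive e ->
  stellar e A t -> exists r dep, depth_function A r (depth t) dep.
Proof.
move=> e_sym e_irr; elim=> {A t} [r|r A P child rA r_link P_part P_gt1 _ IH sep].
  exists r, (fun=> 0%N); split=> //; first by rewrite set11.
  - by move=> v /set1P->; rewrite eqxx.
  - by move=> v /set1P->; rewrite eqxx.
  - by move=> u v /set1P-> /set1P->; rewrite e_irr.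
  - by move=> v /set1P->; rewrite eqxx.
have /fin_all_exists[rd good] : forall B, exists rd : T * (T -> nat),
    B \in P -> depth_function B rd.1 (depth (child B)) rd.2.
  move=> B; case: (boolP (B \in P)) => [/IH[rB [dB gB]]|_].
    by exists (rB, dB).
  by exists (r, fun=> 0%N).
have [/eqP P_cover P_triv _] := and3P P_part.
have block v : v \in A -> v != r -> exists2 B, B \in P & v \in B.
  move=> vA vr; have : v \in finset.cover P by rewrite P_cover !inE vr.
  by move/finset.bigcupP => [B BP vB]; exists B.
have blockS B v : B \in P -> v \in B -> v \in A /\ v != r.
  move=> BP vB; have : v \in finset.cover P by apply/finset.bigcupP; exists B.
  by rewrite P_cover !inE => /andP[].
have other B : B \in P -> exists2 B', B' \in P & B' != B.
  move=> BP; have : (0 < #|P :\ B|)%N by move: P_gt1; rewrite (cardsD1 B) BP.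
  by move/card_gt0P => [B' /setD1P[? ?]]; exists B'.
have root_other B v : B \in P -> v \in B -> exists c,
    [/\ c \in A, c != v, c != r, ~~ e v c & exists2 B', B' \in P & c = (rd B').1].
  move=> BP vB; have [B' B'P neqB] := other B BP.
  have cB' := root_in (good B' B'P); have [cA cr] := blockS B' _ B'P cB'.
  exists (rd B').1; split=> //; last by exists B'.
  - apply: contraNneq neqB => cv; rewrite cv in cB'.
    by rewrite -(def_pblock P_triv B'P cB') -(def_pblock P_triv BP vB).
  - by apply: (sep B B') => //; rewrite eq_sym.
pose dep v := if v == r then 0%N else ((rd (finset.pblock P v)).2 v).+1.
have depE B v : B \in P -> v \in B -> dep v = ((rd B).2 v).+1.
  move=> BP vB; have [_ /negbTE vr] := blockS B v BP vB.
  by rewrite /dep vr (def_pblock P_triv BP vB).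
have same_block u v : u \in A -> v \in A -> u != r -> v != r -> e u v ->
    exists B, [/\ B \in P, u \in B & v \in B].
  move=> uA vA ur vr euv; have [B BP uB] := block u uA ur.
  have [B' B'P vB'] := block v vA vr; exists B; split=> //.
  have [->//|BB'] := eqVneq B B'.
  by have := sep B B' u v BP B'P BB' uB vB'; rewrite euv.
exists r, dep; split=> //.
- by move=> v vA vr; apply: r_link; rewrite !inE vr.
- by rewrite /dep eqxx.
- by move=> v _ /negbTE vr; rewrite /dep vr.
- move=> v vA; have [->|vr] := eqVneq v r; first by rewrite /dep eqxx.
  have [B BP vB] := block v vA vr; rewrite (depE B)//.
  exact: leq_ltn_trans (dep_le (good B BP) vB) (depth_child _ _ BP).
- move=> u v uA vA euv; rewrite {1}/dep; case: (eqVneq u r) => ur.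
    rewrite /dep; case: (eqVneq v r) => // vr.
    by rewrite ur vr e_irr in euv.
  rewrite /dep; case: (eqVneq v r) => [//|vr].
  have [B [BP uB vB]] := same_block u v uA vA ur vr euv.
  rewrite (def_pblock P_triv BP uB) (def_pblock P_triv BP vB) eqSS.
  exact: dep_link (good B BP) _ _ uB vB euv.
- move=> u v uA vA euv; have [->|vr] := eqVneq v r.
    by rewrite {2}/dep eqxx.
  have [ur _|ur] := eqVneq u r.
    have [B BP vB] := block v vA vr.
    have [c [cA cv cr evc _]] := root_other B v BP vB.
    by exists c; split=> //; rewrite ur r_link// !inE cr.
  have [B [BP uB vB]] := same_block u v uA vA ur vr euv.
  rewrite (depE B u)// (depE B v)// ltnS => /(dep_ancestor (good B BP) uB vB euv).
  by move=> [c [cB cv ? ?]]; exists c; split=> //; have [] := blockS B c BP cB.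
- move=> v vA vr; have [B BP vB] := block v vA vr.
  (* All block roots have depth one, so another block root serves as sibling. *)
  have [v_root|v_root] := eqVneq v (rd B).1.
    have [c [cA cv cr evc [B' B'P cB']]] := root_other B v BP vB.
    exists c; split=> //; rewrite (depE B' c)// ?(depE B v)//; last first.
      by rewrite cB'; exact: root_in (good B' B'P).
    by rewrite cB' v_root (root_dep (good B BP)) (root_dep (good B' B'P)).
  have [c [cB cv evc dcv]] := dep_sibling (good B BP) vB v_root.
  exists c; split=> //; first by have [] := blockS B c BP cB.
  by rewrite !(depE B)// dcv.
Qed.

End StellarNetworks.

(** * Linking levels to outside receivers *)

Section Extension.
Variables (n : nat) (g : network n) (C : {set 'I_n}).
Variables (r : 'I_n) (m : nat) (dep : 'I_n -> nat).
Hypotheses (C_closed : forall i j, i \in C -> g i j -> j \in C).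
Hypotheses (depP : depth_function g C r m dep) (m_le : (m <= #|~: C|)%N).

(* Thus a node observes an outside receiver that none of its ancestors does. *)
Definition level_link : rel 'I_n := fun v j =>
  [&& v \in C, j \notin C & dep v == (index j (enum (~: C))).+1].

Definition levels : rel 'I_n := fun i j => [|| g i j, level_link i j | level_link j i].

Lemma levels_sym : symmetric levels.
Proof. by move=> i j; rewrite /levels link_sym [_ || level_link j i]orbC. Qed.

Lemma levels_irr : irreflexive levels.
Proof.
move=> i; rewrite /levels link_irr /level_link /=.
by case: (i \in C).
Qed.

Definition level_network : network n := Network levels_sym levels_irr.

Lemma levels_in i j : i \in C -> j \in C -> levels i j = g i j.
Proof. by move=> iC jC; rewrite /levels /level_link iC jC /= !orbF. Qed.

Lemma levels_out i j : i \in C -> j \notin C ->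
  levels i j = (dep i == (index j (enum (~: C))).+1).
Proof.
move=> iC jC; rewrite /levels /level_link iC (negbTE jC) /= orbF.
by case: (boolP (g i j)) => // /(C_closed iC); rewrite (negbTE jC).
Qed.

Lemma level_receiver i : i \in C -> i != r -> exists2 j, j \notin C & levels i j.
Proof.
move=> iC ir; have d_gt0 := dep_gt0 depP iC ir.
have d_lt : ((dep i).-1 < size (enum (~: C)))%N.
  by rewrite -cardE prednK// (leq_trans (dep_le depP iC)).
(* Depth [d] sits at position [d - 1] of the enumeration; [r] is only the default of [nth]. *)
have jC : nth r (enum (~: C)) (dep i).-1 \notin C.
  by have := mem_nth r d_lt; rewrite mem_enum inE.
exists (nth r (enum (~: C)) (dep i).-1) => //.
by rewrite levels_out// index_uniq ?enum_uniq// prednK.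
Qed.

(** An inclusion between distinct receivers forces a link, as [i'] is in its own neighborhood; each
    kind of link meeting [C] is refuted by a witness. *)
Lemma level_network_antichain i i' :
  neighborhood level_network i' \subset neighborhood level_network i ->
  i = i' \/ (i \notin C /\ i' \notin C).
Proof.
move/fintype.subsetP => sub.
have {}sub j : (j == i') || levels i' j -> (j == i) || levels i j.
  by have := sub j; rewrite !inE; apply.
have [->|neq] := eqVneq i i'; [by left|right].
have := sub i'; rewrite eqxx => /(_ isT); rewrite eq_sym (negbTE neq)/= => ii'.
have [i'C|i'C] := boolP (i' \in C); have [iC|iC] := boolP (i \in C); last by [].
- exfalso; rewrite levels_in// in ii'.
  case: (ltngtP (dep i) (dep i')) => [lt_d|lt_d|eq_d].
  (* The deeper node [i'] sees the outside receiver of its level, which [i] does not. *)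
  + have i'r : i' != r by apply: contraTneq lt_d => ->; rewrite (root_dep depP).
    have [z zC i'z] := level_receiver i'C i'r.
    have := sub z; rewrite i'z orbT => /(_ isT).
    case: (eqVneq z i) => [zi|_] /=; first by rewrite zi iC in zC.
    by move: i'z; rewrite !levels_out// => /eqP <- /eqP di; rewrite di ltnn in lt_d.
  + have i'i : g i' i by rewrite link_sym.
    have [c [cC ci ic nic]] := dep_ancestor depP i'C iC i'i lt_d.
    have := sub c; rewrite levels_in// ic orbT => /(_ isT).
    by rewrite (negbTE ci) levels_in// (negbTE nic).
  + by have := dep_link depP iC i'C ii'; rewrite eq_d eqxx.
(* [i'] sees the root, but depth 0 is linked to no outside receiver. *)
- exfalso; have rC := root_in depP.
  have : (r == i) || levels i r.
    apply: sub; case: (eqVneq r i') => //= i'r; rewrite levels_in// link_sym.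
    by apply: (root_link depP) => //; rewrite eq_sym.
  case: (eqVneq r i) => [ri|_] /=; first by rewrite -ri rC in iC.
  by rewrite levels_sym levels_out// (root_dep depP).
(* The outside receiver [i'] also sees a node of the depth of [i] that is not linked to [i]. *)
- exfalso; have di : (0 < dep i)%N.
    by move: ii'; rewrite levels_out// => /eqP ->.
  have ir : i != r by apply: contraTneq di => ->; rewrite (root_dep depP).
  have [c [cC ci nic dc]] := dep_sibling depP iC ir.
  have := sub c; rewrite levels_sym levels_out// dc -levels_out// ii' orbT => /(_ isT).
  by rewrite (negbTE ci) levels_in// (negbTE nic).
Qed.

Lemma level_network_extension : (1 < #|C|)%N -> extension g level_network.
Proof.
move=> C_gt1; split; first by move=> i j gij; rewrite /= /levels gij.
have : (0 < #|C :\ r|)%N by move: C_gt1; rewrite (cardsD1 r) (root_in depP).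
move/card_gt0P => [v /setD1P[vr vC]].
have [z zC vz] := level_receiver vC vr.
exists v, z; rewrite /= vz /=; apply: contra zC; exact: C_closed.
Qed.

End Extension.

(** * Random coalitions from cyclic rotations *)

Lemma card_rotation c q a : (q <= c)%N ->
  #|[set j : 'I_c | ((a + j) %% c < q)%N]%SET| = q.
Proof.
case: c => [|c] qc; first by move: qc; rewrite leqn0 => /eqP ->; apply: eq_card0 => -[].
transitivity (\sum_(j < c.+1 | j < q) 1)%N; last first.
  by rewrite (big_ord_narrow qc) sum1_card card_ord.
rewrite -sum1dep_card big_mkcond [RHS]big_mkcond /=.
elim: a => [|a IH]; first by apply: eq_bigr => j _; rewrite add0n modn_small.
(* Raising [a] by one moves the first term to the end, where [a + c.+1] has the same residue as
   [a]. *)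
rewrite -IH big_ord_recr big_ord_recl /= addnC addn0 addSnnS modnDr; congr addn.
by apply: eq_bigr => j _; rewrite addSnnS.
Qed.

Section Rotations.
Variables (n : nat) (C : {set 'I_n}).

(** A cyclic window of [q] members of [C], which covers each member equally often as [j] varies. *)
Definition rotation (q : nat) (j : 'I_#|C|) : {set 'I_n} :=
  [set i in C | ((index i (enum C) + j) %% #|C| < q)%N]%SET.

Lemma card_rotation_set q j : (q <= #|C|)%N -> #|rotation q j| = q.
Proof.
move=> qC; rewrite -[RHS](@card_rotation #|C| q j)// -!sum1dep_card.
rewrite big_mkcondr -big_enum /=.
case: (set_0Vmem C) => [C0|[i0 _]].
  by have := ltn_ord j; rewrite {2}C0 cards0.
rewrite (big_nth i0) big_mkord -cardE [RHS]big_mkcond /=; apply: eq_bigr => a _.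
by rewrite index_uniq ?enum_uniq -?cardE// addnC.
Qed.

Lemma card_rotation_in q i : (q <= #|C|)%N ->
  #|[set j | i \in rotation q j]%SET| = if i \in C then q else 0%N.
Proof.
move=> qC; case: ifP => iC.
  rewrite -[RHS](@card_rotation #|C| q (index i (enum C)))//.
  by apply: eq_card => j; rewrite !inE iC.
by apply/eqP; rewrite cards_eq0; apply/eqP/setP => j; rewrite !inE iC.
Qed.

(* Conditionally on a nonempty coalition, the receivers outside C belong to it
   all together with probability k / n, and otherwise not at all. *)
Lemma uniform_coalitions (R : realFieldType) (k : nat) (q : R) :
  0 <= q -> q <= 1 -> (n - #|C| <= k)%N -> (k <= #|C|)%N -> (0 < #|C|)%N ->
  exists (J : finType) (p : J -> R) (B : J -> {set 'I_n}),
    [/\ forall j, 0 <= p j, \sum_j p j = 1,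
        forall i, \sum_(j | i \in B j) p j = q * (k%:R / n%:R),
        q <= \sum_(j | (k <= #|B j|)%N) p j
      & forall i i' j, i \notin C -> i' \notin C -> i \in B j -> i' \in B j].
Proof.
move=> q_ge0 q_le1 mk kC C_gt0.
have Cn : (#|C| <= n)%N by rewrite -[leqRHS]card_ord max_card.
pose m := (n - #|C|)%N.
have n_gt0 : 0 < n%:R :> R by rewrite ltr0n (leq_trans C_gt0).
have c_gt0 : 0 < #|C|%:R :> R by rewrite ltr0n.
have kn1 : k%:R / n%:R <= 1 :> R by rewrite ler_pdivrMr// mul1r ler_nat (leq_trans kC).
have kn0 : 0 <= k%:R / n%:R :> R by rewrite divr_ge0.
(* Case 0 takes all outside receivers and [k - m] members of [C], case 1 takes [k] members of [C],
   case 2 nobody. A member of [C] has probability [q * (k / n) * ((k - m) + (n - k)) / #|C|], and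
   [n - m = #|C|]. *)
pose w (a : 'I_3) : R := match val a with
  0 => q * (k%:R / n%:R) | 1 => q * (1 - k%:R / n%:R) | _ => 1 - q end.
pose p (x : 'I_3 * 'I_#|C|) : R := w x.1 / #|C|%:R.
pose B (x : 'I_3 * 'I_#|C|) : {set 'I_n} := match val x.1 with
  0 => ~: C :|: rotation (k - m) x.2 | 1 => rotation k x.2 | _ => finset.set0 end.
have w_ge0 a : 0 <= w a.
  rewrite /w; case: (val a) => [|[|_]]; first exact: mulr_ge0.
    by rewrite mulr_ge0// subr_ge0.
  by rewrite subr_ge0.
have sum_p (Q : pred ('I_3 * 'I_#|C|)) : \sum_(x | Q x) p x =
    \sum_a w a * (#|[set j | Q (a, j)]%SET|%:R / #|C|%:R).
  rewrite (eq_bigl (fun x => predT x.1 && Q (x.1, x.2))); last by case.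
  rewrite (eq_bigr (fun x => w x.1 / #|C|%:R)); last by case.
  rewrite -(pair_big_dep predT (fun a j => Q (a, j)) (fun a _ => w a / #|C|%:R)).
  apply: eq_bigr => a _; rewrite sumr_const mulrCA mulrA -[LHS]mulr_natl mulrA.
  by congr (_%:R * _ / _); apply: eq_card => j; rewrite inE.
exists ('I_3 * 'I_#|C|)%type, p, B; split.
- by move=> x; rewrite divr_ge0.
- rewrite sum_p !big_ord_recl big_ord0 /w /= !cardsT card_ord.
  by field; rewrite ?gt_eqF.
- move=> i; rewrite sum_p !big_ord_recl big_ord0 /w /B /=.
  have -> : #|[set j : 'I_#|C| | i \in finset.set0]%SET| = 0%N.
    by apply: eq_card0 => j; rewrite !inE.
  rewrite card_rotation_in//; case: ifP => iC.
    have -> : [set j | i \in ~: C :|: rotation (k - m) j]%SET =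
        [set j | i \in rotation (k - m) j]%SET.
      by apply/setP => j; rewrite !inE iC.
    rewrite card_rotation_in ?iC; last by rewrite (leq_trans (leq_subr _ _)).
    by rewrite natrB// natrB//; field; rewrite ?gt_eqF.
  have -> : [set j | i \in ~: C :|: rotation (k - m) j]%SET = [set: 'I_#|C|]%SET.
    by apply/setP => j; rewrite !inE iC.
  by rewrite cardsT card_ord; field; rewrite ?gt_eqF.
- rewrite sum_p !big_ord_recl big_ord0 /w /B /=.
  have -> : [set j | (k <= #|~: C :|: rotation (k - m) j|)%N]%SET = [set: 'I_#|C|]%SET.
    apply/setP => j; rewrite !inE cardsU card_rotation_set; last first.
      by rewrite (leq_trans (leq_subr _ _)).
    rewrite (_ : ~: C :&: _ = finset.set0) ?cards0 ?subn0; last first.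
      by apply/setP => i; rewrite !inE; case: (i \in C).
    have := cardsC C; rewrite card_ord /m; lia.
  have -> : [set j | (k <= #|rotation k j|)%N]%SET = [set: 'I_#|C|]%SET.
    by apply/setP => j; rewrite !inE card_rotation_set// leqnn.
  rewrite cardsT card_ord divff ?gt_eqF// !mulr1 mulrBr mulr1 addrA subrKC.
  by rewrite lerDl addr0 mulr_ge0// ?subr_ge0// divr_ge0.
- move=> i i' [a j] iC i'C; rewrite /B /=; case: (val a) => [|[|_]].
  + by rewrite !inE iC i'C.
  + by rewrite !inE (negbTE iC).
  + by rewrite inE.
Qed.
End Rotations.

(** * Comparing the network with its extension *)

Lemma component_closed (n : nat) (g : network n) (C : {set 'I_n}) i j :
  component g C -> i \in C -> g i j -> j \in C.
Proof.
by move=> [i0 ->]; rewrite !inE => i0i gij; apply: connect_trans (connect1 gij).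
Qed.

Theorem theorem1 (R : realType) (n k : nat) (M : countType)
  (M_infinite : infinite_set [set: M])
  (prior : state -> R)
  (prior_gt0 : forall w : state, 0 < prior w)
  (prior_sum1 : \sum_(w : state) prior w = 1)
  (k_ge : ((n + 1) %/ 2 <= k)%N) (k_le : (k <= n)%N)
  (prior_lt : prior X < k%:R / (n + k)%:R)
  (g : network n) (C : {set 'I_n}) (t : rtree 'I_n) (l : nat)
  (C_component : component g C)
  (C_stellar : stellar g C t) (C_depth : depth t = l)
  (l_ge1 : (1 <= l)%N)
  (C_card : (k < #|C|)%N)
  (C_outside : (l <= #|[set i : 'I_n | i \notin C]%SET|)%N) :
  exists g' : network n,
    [/\ extension g g',
        network_value M k prior g < network_value M k prior g'
      & network_value M k prior g' =
        network_value M k prior (empty_network n)].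
Proof.
have [r [dep depP]] := stellar_depth_function (@link_sym n g) (@link_irr n g) C_stellar.
have C_closed i j : i \in C -> g i j -> j \in C := component_closed C_component.
have rC := root_in depP.
have card_C_le : (#|C| <= n)%N by rewrite -[leqRHS]card_ord max_card.
have k_gt0 : (0 < k)%N by lia.
have n_gt0 : (0 < n)%N by lia.
pose a := prior X; pose b := prior Y.
have a_gt0 : 0 < a := prior_gt0 X.
have b_gt0 : 0 < b := prior_gt0 Y.
have ab : a + b = 1 by rewrite -prior_sum1 big_state.
have k0 : 0 < k%:R :> R by rewrite ltr0n.
have n0 : 0 < n%:R :> R by rewrite ltr0n.
(* With this [q] each receiver joins the coalition with probability [a / b] in state Y, so obedience
   binds for all; [prior_lt] gives [q <= 1]. *)
pose q := n%:R * a / (k%:R * b).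
have q_ge0 : 0 <= q by rewrite divr_ge0 ?mulr_ge0 ?ltW.
have q_le1 : q <= 1.
  rewrite ler_pdivrMr ?mulr_gt0// mul1r.
  move: prior_lt; rewrite -/a ltr_pdivlMr ?ltr0n ?addn_gt0 ?n_gt0// natrD.
  have -> : b = 1 - a by rewrite -ab addrC addKr.
  lra.
(* As [n <= 2k] and [k < #|C|], a coalition of size [k] has room for all outside receivers. *)
have outside_le : (n - #|C| <= k)%N by lia.
have [J [p [B [p_ge0 p_sum1 pB qB B_out]]]] :=
  uniform_coalitions q_ge0 q_le1 outside_le (ltnW C_card)
    (leq_ltn_trans (leq0n _) C_card).
pose V := (n + k)%:R / k%:R * a.
have obedient i : (\sum_(j | i \in B j) p j) * b <= a.
  suff -> : (\sum_(j | i \in B j) p j) * b = a by [].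
  by rewrite pB /q; field; rewrite ?gt_eqF.
have value_V (h : network n) : (forall i i' j,
    neighborhood h i' \subset neighborhood h i -> i \in B j -> i' \in B j) ->
    network_value M k prior h = V.
  move=> nested.
  have [pi piV] :=
    sharing_experiment M_infinite prior_gt0 k_le p_ge0 p_sum1 obedient nested.
  have V_ub : ubound [set value k prior h pi | pi in [set: experiment R n M]] V.
    by move=> _ [pi' _ <-]; exact: value_le.
  apply/eqP; rewrite eq_le; apply/andP; split.
    by apply: ge_sup V_ub; exists (value k prior h pi), pi.
  apply: le_trans (ub_le_sup (ex_intro _ V V_ub) (ex_intro2 _ _ pi I erefl)).
  apply: le_trans piV; rewrite -/a -/b.
  have -> : V = a + b * q by rewrite /V /q natrD; field; rewrite ?gt_eqF.
  by rewrite lerD2l ler_wpM2l// ltW.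
have m_le : (depth t <= #|~: C|)%N.
  rewrite C_depth; apply: leq_trans C_outside _; apply: subset_leq_card.
  by apply/fintype.subsetP => i; rewrite !inE.
have empty_nested i i' j :
    neighborhood (empty_network n) i' \subset neighborhood (empty_network n) i ->
    i \in B j -> i' \in B j.
  by move=> /fintype.subsetP/(_ i'); rewrite !inE /= !orbF eqxx => /(_ isT)/eqP ->.
have empty_V : network_value M k prior (empty_network n) = V := value_V _ empty_nested.
have net_V : network_value M k prior (level_network g C dep) = V.
  apply: value_V => i i' j /(level_network_antichain C_closed depP m_le).
  by case=> [->//|[iC i'C]]; exact: B_out.
exists (level_network g C dep); rewrite net_V empty_V; split=> //.
  by apply: (level_network_extension C_closed depP m_le); lia.
(* [pi0] only shows that the set of values on [g] is nonempty. *)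
have [pi0 _] := sharing_experiment M_infinite prior_gt0 k_le p_ge0 p_sum1
  obedient empty_nested.
apply: (@le_lt_trans _ _ (((n + k)%:R / k%:R - (2 * k)%:R^-1) * a)).
  apply: ge_sup; first by exists (value k prior g pi0), pi0.
  move=> _ [pi _ <-]; apply: (value_le_universal pi prior_gt0 rC C_card k_gt0) => i iC.
  (* [C] is closed under links and [r] is linked to the rest of it, so its neighborhood contains
     those of all nodes of [C]. *)
  apply/fintype.subsetP => j; rewrite !inE => ij.
  case: eqVneq => //= jr; apply: (root_link depP) => //.
  by case/orP: ij => [/eqP->//|/(C_closed _ _ iC)].
by rewrite /V ltr_pM2r// gtrBl invr_gt0 ltr0n muln_gt0.
Qed.
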